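(* $$f_2(k)\le\frac{2^{k+1}}{ek}+O\left(\frac{2^{k+1}}{k^{3/2}}\right)\quad\text{as } k\to\infty.$$
   Context: A $(k,d)$-tree is a finite rooted binary tree in which every non-leaf vertex has exactly two children and which satisfies: (i) there is no leaf at distance less than $k$ from the root, and (ii) for every vertex $v$ there are at most $d$ leaves among the descendants of $v$ at distance at most $k$ from $v$. $f_2(k)$ is the largest integer $d$ such that no $(k,d)$-tree exists. *)

(* Defs.v *)
From mathcomp Require Import all_boot all_order all_algebra.
From mathcomp Require Import all_classical all_reals all_analysis.

Set Implicit Arguments.
Unset Strict Implicit.
Unset Printing Implicit Defensive.

(* Finite rooted trees in which every non-leaf vertex has exactly two children.
   The order of the two children plays no role below. *)
Inductive bintree : Type :=
| Leaf
| Node of bintree & bintree.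

(* One entry per leaf: its distance from the root. *)
Fixpoint leaf_depths (t : bintree) : seq nat :=
  match t with
  | Leaf => [:: 0]
  | Node l r => [seq n.+1 | n <- leaf_depths l ++ leaf_depths r]
  end.

(* One entry per vertex v: the subtree rooted at v, whose vertices are the
   descendants of v (v included). *)
Fixpoint vertices (t : bintree) : seq bintree :=
  t :: match t with
       | Leaf => [::]
       | Node l r => vertices l ++ vertices r
       end.

Definition is_kd_tree (k d : nat) (t : bintree) : bool :=
  ~~ has (fun n => n < k) (leaf_depths t) &&
  all (fun v => count (fun n => n <= k) (leaf_depths v) <= d) (vertices t).

Definition no_kd_tree (k : nat) : pred nat :=
  fun d => `[< ~ exists t, is_kd_tree k d t >].

Lemma no_kd_tree0 (k : nat) : no_kd_tree k 0.
Proof.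
apply/asboolP => -[t /andP[_]].
suff: ~~ all (fun v => count (fun n => n <= k) (leaf_depths v) <= 0) (vertices t).
  by move/negP.
elim: t => //= l IHl r _.
by rewrite all_cat (negPf IHl) andbF.
Qed.

Lemma ex_no_kd_tree (k : nat) : exists d, no_kd_tree k d.
Proof. by exists 0; exact: no_kd_tree0. Qed.

Fixpoint full_bintree (k : nat) : bintree :=
  if k is j.+1 then Node (full_bintree j) (full_bintree j) else Leaf.

Lemma leaf_depths_full (k : nat) :
  leaf_depths (full_bintree k) = nseq (2 ^ k) k.
Proof.
elim: k => //= k ->.
by rewrite -nseqD addnn -mul2n -expnS map_nseq.
Qed.

Lemma no_kd_tree_le (k d : nat) : no_kd_tree k d -> d <= 2 ^ k.
Proof.
move=> /asboolP nd; rewrite leqNgt; apply/negP => lt_d; apply: nd.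
exists (full_bintree k); apply/andP; split.
  by rewrite leaf_depths_full has_nseq ltnn andbF.
suff H j : j <= k ->
    all (fun v => count (fun n => n <= k) (leaf_depths v) <= d)
        (vertices (full_bintree j)) by exact: H.
have size_le i : i <= k ->
    count (fun n => n <= k) (leaf_depths (full_bintree i)) <= d.
  move=> le_i; apply: leq_trans (count_size _ _) _.
  rewrite leaf_depths_full size_nseq; apply: leq_trans (ltnW lt_d).
  by rewrite leq_exp2l.
elim: j => [|j IHj] lejk; first by have := size_le 0 lejk; rewrite /= andbT.
have /= -> := size_le j.+1 lejk.
by rewrite all_cat IHj // ltnW.
Qed.

Definition f2 (k : nat) : nat := ex_maxn (ex_no_kd_tree k) (@no_kd_tree_le k).

(* Main.v *)
Require Import Defs.
From mathcomp Require Import all_boot all_order all_algebra.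
From mathcomp Require Import all_classical all_reals all_analysis.
From mathcomp Require Import zify ring lra.
Import Order.TTheory GRing.Theory Num.Theory.
Import numFieldNormedType.Exports.
Local Open Scope classical_set_scope.
Local Open Scope ring_scope.

(* The tree is built downwards from a budget: x_i bounds the number of leaves
   at distance i from the current vertex, and x_i / 2^i is its Kraft weight.
   Splitting a budget evenly between the two children preserves the weight and
   shifts it one level up, while d / 2 new leaves may be added at level k.  We
   work with blocks of r ~ sqrt k levels, hence with M ~ sqrt k blocks.  After
   r levels the oldest block, of weight p, is handed over entirely to a fraction
   p of the 2^r vertices, which Kraft's inequality completes at once; the others
   share the remaining leaves, so their weights grow by 1 / (1 - p).  If delta
   is the weight of a new block, a steady state satisfies
   delta = p (1 - p)^(M - 1) <= 1 / (e (M - 1)).  For any larger delta the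
   weights grow until their total exceeds 1, and Kraft's inequality completes
   the tree; delta ~ 1 / (e M) corresponds to d ~ 2^(k+1) / (e k). *)

(** * Leaf counts, grafted trees and Kraft's inequality *)

Section Trees.
Local Open Scope nat_scope.
Implicit Types (t q s : bintree) (i h m k d D : nat).

Definition leaves_at t i := count_mem i (leaf_depths t).

Definition leaves_within k t := count (fun n => n <= k) (leaf_depths t).

Definition locally_sparse k d t :=
  all (fun v => leaves_within k v <= d) (vertices t).

Lemma leaves_at_node0 t s : leaves_at (Node t s) 0 = 0.
Proof.
by rewrite /leaves_at /= count_map (eq_count (a2 := pred0)) ?count_pred0.
Qed.

Lemma leaves_at_nodeS t s i :
  leaves_at (Node t s) i.+1 = leaves_at t i + leaves_at s i.
Proof. by rewrite /leaves_at /= count_map -count_cat; apply: eq_count. Qed.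

Lemma leaves_within_nodeS k t s :
  leaves_within k.+1 (Node t s) = leaves_within k t + leaves_within k s.
Proof. by rewrite /leaves_within /= count_map -count_cat; apply: eq_count. Qed.

Lemma size_leaves_node t s :
  size (leaf_depths (Node t s)) = size (leaf_depths t) + size (leaf_depths s).
Proof. by rewrite /= size_map size_cat. Qed.

Lemma leaves_within_sum k t :
  leaves_within k t = \sum_(i < k.+1) leaves_at t i.
Proof.
rewrite /leaves_within /leaves_at; elim: (leaf_depths t) => [|n l IH] /=.
  by rewrite big1.
rewrite big_split /= -IH; congr (_ + _).
have [nk|nk] := leqP n k.
  rewrite (bigD1 (Ordinal (nk : n < k.+1))) //= eqxx big1 ?addn0 // => i.
  by rewrite -val_eqE /= eq_sym => /negPf ->.
rewrite big1 // => i _; case: eqP => // e.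
by have := ltn_ord i; rewrite -e ltnS leqNgt nk.
Qed.

Lemma leaves_within_le_size k t : leaves_within k t <= size (leaf_depths t).
Proof. exact: count_size. Qed.

Lemma locally_sparse_node k d t s :
  locally_sparse k d (Node t s) =
  [&& leaves_within k (Node t s) <= d, locally_sparse k d t
    & locally_sparse k d s].
Proof. by rewrite /locally_sparse -all_cat. Qed.

Lemma locally_sparse_size k d t :
  size (leaf_depths t) <= d -> locally_sparse k d t.
Proof.
elim: t => [|t IHt s IHs] Hd.
  by rewrite /locally_sparse /= andbT (leq_trans (leaves_within_le_size _ _)).
rewrite locally_sparse_node (leq_trans (leaves_within_le_size _ _) Hd) /=.
have Hd' := Hd; rewrite size_leaves_node in Hd'.
by rewrite IHt ?IHs //; apply: leq_trans Hd'; rewrite ?leq_addr ?leq_addl.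
Qed.

(* Full binary tree of height h whose bottom vertices are replaced, from left
   to right, by m copies of q and then by copies of s. *)
Fixpoint graft h m q s : bintree :=
  if h is h'.+1 then Node (graft h' m q s) (graft h' (m - 2 ^ h') q s)
  else if m is 0 then s else q.

Lemma leaves_at_graft_lt h m q s i : i < h -> leaves_at (graft h m q s) i = 0.
Proof.
elim: h m i => [|h IH] m [|i] //= lt_ih; first by rewrite leaves_at_node0.
by rewrite leaves_at_nodeS !IH.
Qed.

Lemma leaves_at_graft h m q s i :
  leaves_at (graft h m q s) (i + h) =
  minn m (2 ^ h) * leaves_at q i + (2 ^ h - m) * leaves_at s i.
Proof.
elim: h m => [|h IH] m; first by rewrite addn0 /=; case: m => [|m] /=; lia.
by rewrite addnS /= leaves_at_nodeS !IH expnS; nia.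
Qed.

(** Each bottom vertex is charged with both [q] and [s], so [m] drops out; the waste is later
    absorbed by the term [2 ^+ (4 * r)]. *)
Lemma leaves_within_graft h m q s k :
  leaves_within (k + h) (graft h m q s) <=
  2 ^ h * (leaves_within k q + leaves_within k s).
Proof.
elim: h m => [|h IH] m; first by rewrite addn0 /=; case: m => [|m]; lia.
rewrite addnS /= leaves_within_nodeS expnS -mulnA mul2n -addnn.
exact: leq_add.
Qed.

(** A vertex of the upper part roots a graft of some height [j]; its leaves within distance [k] are
    those within [k - j] of the bottom vertices. *)
Lemma locally_sparse_graft k d h m q s : h <= k ->
  locally_sparse k d q -> locally_sparse k d s ->
  (forall j, j <= h ->
     2 ^ j * (leaves_within (k - j) q + leaves_within (k - j) s) <= d) ->
  locally_sparse k d (graft h m q s).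
Proof.
move=> + sq ss; elim: h m => [|h IH] m hk Hd; first by case: m.
have Hroot : leaves_within k (graft h.+1 m q s) <= d.
  by rewrite -{1}(subnK hk) (leq_trans (leaves_within_graft _ _ _ _ _)) ?Hd.
rewrite [graft _ _ _ _]/= locally_sparse_node Hroot andTb.
by apply/andP; split; apply: IH; rewrite ?(ltnW hk) // => j jh; apply/Hd/leqW.
Qed.

(* Kraft's inequality as an existence statement.  When no leaf sits at the
   root, a first subtree uses up weight exactly 1/2, so enough remains for the
   second one. *)
Lemma kraft D (n : nat -> nat) :
  2 ^ D <= \sum_(i < D.+1) n i * 2 ^ (D - i) ->
  exists t, [/\ forall i, i <= D -> leaves_at t i <= n i,
    forall i, D < i -> leaves_at t i = 0,
    \sum_(i < D.+1) leaves_at t i * 2 ^ (D - i) = 2 ^ D &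
    size (leaf_depths t) <= 2 ^ D].
Proof.
elim: D n => [|D IH] n.
  rewrite big_ord1 expn0 muln1 => n0; exists Leaf; split=> // [[|i]//|[|i]//|].
  by rewrite big_ord1.
have [n0|n0] := posnP (n 0); last first.
  move=> _; exists Leaf; split=> // [[|i]//|[|i]//||]; last by rewrite expn_gt0.
  by rewrite big_ord_recl big1 // subn0 addn0 mul1n.
rewrite big_ord_recl n0 mul0n add0n.
under eq_bigr => i _ do rewrite lift0 subSS.
move=> H.
have HD : 2 ^ D.+1 = 2 ^ D + 2 ^ D by rewrite expnS mul2n addnn.
have [|t [t1 t2 t3 t4]] := IH (fun i => n i.+1).
  by apply: leq_trans H; rewrite HD leq_addr.
have [|s [s1 s2 s3 s4]] := IH (fun i => n i.+1 - leaves_at t i).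
  rewrite -(leq_add2l (2 ^ D)) -HD -[X in _ <= X + _]t3 -big_split /=.
  apply: leq_trans H _; apply: leq_sum => i _.
  by rewrite -mulnDl subnKC // t1 // -ltnS.
exists (Node t s); split.
- case=> [|i] iD; first by rewrite leaves_at_node0.
  by rewrite leaves_at_nodeS -(subnKC (t1 i iD)) leq_add2l s1.
- by case=> [|i] iD //; rewrite leaves_at_nodeS t2 ?s2.
- rewrite big_ord_recl leaves_at_node0 mul0n add0n.
  under eq_bigr => i _ do
    rewrite lift0 subSS leaves_at_nodeS mulnDl.
  by rewrite big_split /= t3 s3 HD.
- by rewrite size_leaves_node HD leq_add.
Qed.

Lemma f2_no_kd_tree k t : ~~ is_kd_tree k (f2 k) t.
Proof.
rewrite /f2; case: ex_maxnP => d /asboolP nd _.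
by apply/negP => ht; apply: nd; exists t.
Qed.

End Trees.

(** * Trees fitting a real budget *)

(* Real budgets never have to be rounded when they are split among subtrees. *)
Definition constructible (R : realType) (k d : nat) (x : nat -> R) :=
  exists2 t, locally_sparse k d t &
    forall i, (i <= k)%N -> (leaves_at t i)%:R <= x i.

Lemma constructible_le (R : realType) k d (x y : nat -> R) :
  (forall i, (i <= k)%N -> x i <= y i) ->
  constructible R k d x -> constructible R k d y.
Proof.
by move=> xy [t st tx]; exists t => // i ik; apply: le_trans (tx i ik) (xy i ik).
Qed.

Lemma constructible0_kd_tree (R : realType) k d :
  constructible R k d (fun=> 0) -> exists t, is_kd_tree k d t.
Proof.
case=> t st t0; exists t; rewrite /is_kd_tree [X in _ && X]st andbT.
apply/hasPn => i it; rewrite -leqNgt leqNgt; apply/negP => ik.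
have := t0 i (ltnW ik); rewrite lern0 /leaves_at -leqn0 leqNgt -has_count.
by move/negP; apply; apply/hasP; exists i => /=.
Qed.

(** Here [x] is the budget at the root and [y] the one [r] levels further down; the last hypothesis
    gives sparsity at height [h] above the bottom vertices. *)
Lemma constructible_graft (R : realType) k d r m q (x y : nat -> R) :
  (r <= k)%N -> (m <= 2 ^ r)%N -> constructible R k d y ->
  locally_sparse k d q -> (forall i, 0 <= x i) ->
  (forall i, (i + r <= k)%N ->
     m%:R * (leaves_at q i)%:R + (2 ^+ r - m%:R) * y i <= x (i + r)%N) ->
  (forall h, (h <= r)%N ->
     2 ^+ h * ((size (leaf_depths q))%:R + \sum_(i < (k - h).+1) y i) <= d%:R) ->
  constructible R k d x.
Proof.
move=> rk mr [s ss sy] sq x0 Hx Hd; exists (graft r m q s).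
  apply: locally_sparse_graft => // h hr; rewrite -(ler_nat R).
  apply: le_trans (Hd h hr); rewrite natrM natrX ler_pM2l ?exprn_gt0 //.
  rewrite natrD lerD ?ler_nat ?leaves_within_le_size //.
  rewrite leaves_within_sum natr_sum ler_sum // => i _; apply: sy.
  by have := ltn_ord i; lia.
move=> i ik; have [ir|ri] := ltnP i r; first by rewrite leaves_at_graft_lt.
have ik' : (i - r + r <= k)%N by rewrite subnK.
rewrite -{1}(subnK ri) leaves_at_graft (minn_idPl mr) natrD !natrM natrB // natrX.
rewrite -[in x _](subnK ri); apply: le_trans (Hx _ ik').
rewrite lerD2l ler_wpM2l ?sy //; last by lia.
by rewrite subr_ge0 -natrX ler_nat.
Qed.

(** * Budgets made of blocks of [r] levels *)

Lemma sum_ord_rev (V : nmodType) n (F : nat -> V) :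
  \sum_(i < n.+1) F i = \sum_(i < n.+1) F (n - i)%N.
Proof. by rewrite (reindex_inj rev_ord_inj). Qed.

Lemma sum_pow2 (R : realType) n : \sum_(i < n) (2 : R) ^+ i = 2 ^+ n - 1.
Proof.
elim: n => [|n IH]; first by rewrite big_ord0 expr0 subrr.
by rewrite big_ord_recr /= IH exprS; ring.
Qed.

Lemma sum_ord_divn (R : realType) M r (w : nat -> R) : (0 < r)%N ->
  \sum_(u < M * r) w (u %/ r)%N = r%:R * \sum_(a < M) w a.
Proof.
move=> r0; elim: M => [|M IH]; first by rewrite !big_ord0 mulr0.
rewrite mulSn addnC big_split_ord /= IH big_ord_recr /= mulrDr; congr (_ + _).
rewrite (eq_bigr (fun=> w M)) => [|i _].
  by rewrite sumr_const card_ord mulr_natl.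
by rewrite divnMDl // divn_small // addn0.
Qed.

(* Level i of a budget lies in block (k - i) %/ r, counted from the deepest
   level k; w a is the total Kraft weight of block a. *)
Definition profile (R : realType) k r (w : nat -> R) (i : nat) : R :=
  w ((k - i) %/ r)%N * 2 ^+ i / r%:R.

Lemma profile_ge0 (R : realType) k r (w : nat -> R) i :
  (forall a, 0 <= w a) -> 0 <= profile R k r w i.
Proof. by move=> w0; rewrite /profile !mulr_ge0 ?invr_ge0 ?exprn_ge0. Qed.


(* Rounding the budgets down costs less than 2 ^+ n in the weighted sum. *)
Lemma kraft_real (R : realType) D n (x : nat -> R) :
  (n <= D.+1)%N -> (forall i, 0 <= x i) ->
  2 ^+ D + 2 ^+ n <= \sum_(u < n) x (D - u)%N * 2 ^+ u ->
  exists t, [/\ forall i, (i <= D)%N -> (leaves_at t i)%:R <= x i,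
    forall i, (D < i)%N -> leaves_at t i = 0%N &
    (size (leaf_depths t) <= 2 ^ D)%N].
Proof.
move=> nD x0 Hx.
have [|t [t1 t2 _ t4]] := kraft D (fun i => Num.truncn (x i)); last first.
  exists t; split=> // i iD; have /andP[+ _] := truncn_itv (x0 i).
  by apply: le_trans; rewrite ler_nat t1.
rewrite -(ler_nat R) natr_sum natrX.
rewrite (sum_ord_rev _ _ (fun i => (Num.truncn (x i) * 2 ^ (D - i))%:R)).
rewrite -[D.+1](subnKC nD) big_split_ord /=.
rewrite -[leLHS]addr0 lerD ?sumr_ge0 //.
have : \sum_(u < n) (x (D - u)%N - 1) * 2 ^+ u <=
       \sum_(u < n) (Num.truncn (x (D - u)%N) * 2 ^ (D - (D - u)))%:R :> R.
  apply: ler_sum => u _; rewrite subKn; last by have := ltn_ord u; lia.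
  rewrite natrM natrX ler_pM2r ?exprn_gt0 // lerBlDr -[1]/(1%:R) -natrD addn1.
  by have /andP[_ /ltW] := truncn_itv (x0 (D - u)%N).
apply: le_trans; under eq_bigr => u _ do rewrite mulrBl mul1r.
rewrite big_split /= sumrN sum_pow2; lra.
Qed.

(** Seen from [r] levels further down, block [M - 1] is block [M], and each of [m] vertices gets
    weight at least [1 + (2 ^+ r)^-1] of it. The excess pays for rounding because
    [k - M * r >= 2 * r]. *)
Lemma killed_tree (R : realType) k r M m (w : R) :
  (0 < r)%N -> (M * r + 2 * r <= k)%N -> (0 < m)%N -> 0 <= w ->
  m%:R * (1 + (2 ^+ r)^-1) <= w * 2 ^+ r ->
  exists q, [/\ forall i, (i + r <= k)%N -> ((k - i) %/ r)%N = M ->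
      m%:R * (leaves_at q i)%:R <= w * 2 ^+ (i + r) / r%:R,
    forall i, ((k - i) %/ r)%N != M -> leaves_at q i = 0%N &
    (size (leaf_depths q) <= 2 ^ (k - M * r))%N].
Proof.
move=> r0 Mk m0 w0 Hw.
have rR : 0 < r%:R :> R by rewrite ltr0n.
have mR : 0 < m%:R :> R by rewrite ltr0n.
pose x i : R := if ((k - i) %/ r == M)%N then w * 2 ^+ (i + r) / (r%:R * m%:R) else 0.
have x0 i : 0 <= x i.
  rewrite /x; case: ifP => // _.
  by rewrite !mulr_ge0 ?invr_ge0 ?exprn_ge0 ?mulr_ge0 ?ler0n.
have [||t [t1 t2 t3]] := kraft_real R (k - M * r) r x _ x0.
- by lia.
- rewrite (eq_bigr (fun=> w * 2 ^+ (k - M * r + r) / (r%:R * m%:R))); last first.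
    move=> u _; have ur := ltn_ord u.
    have uk : (u <= k - M * r)%N by lia.
    have -> : x (k - M * r - u)%N =
        w * 2 ^+ (k - M * r - u + r) / (r%:R * m%:R).
      rewrite /x ifT //.
      have -> : (k - (k - M * r - u) = M * r + u)%N by lia.
      by rewrite divnMDl // divn_small // addn0.
    have -> : (k - M * r + r = (k - M * r - u + r) + u)%N by lia.
    by rewrite [in RHS]exprD; ring.
  rewrite sumr_const card_ord -[_ *+ r]mulr_natl.
  have -> : r%:R * (w * 2 ^+ (k - M * r + r) / (r%:R * m%:R)) =
      (w * 2 ^+ r) / m%:R * 2 ^+ (k - M * r).
    by rewrite exprD; field; rewrite !lt0r_neq0.
  have H1 : 1 + (2 ^+ r)^-1 <= w * 2 ^+ r / m%:R.
    by rewrite ler_pdivlMr // mulrC.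
  have H2 : 2 ^+ r * 2 ^+ r <= 2 ^+ (k - M * r) :> R.
    by rewrite -exprD ler_eXn2l ?ltr1n //; lia.
  have e0 : 0 < 2 ^+ r :> R by rewrite exprn_gt0.
  have : (1 + (2 ^+ r)^-1) * 2 ^+ (k - M * r) <=
         w * 2 ^+ r / m%:R * 2 ^+ (k - M * r) by rewrite ler_wpM2r ?exprn_ge0.
  apply: le_trans; rewrite mulrDl mul1r lerD2l mulrC ler_pdivlMr //.
- exists t; split => // i.
  + move=> ik iM; have [iD|Di] := leqP i (k - M * r); last first.
      by rewrite t2 // mulr0 !mulr_ge0 ?invr_ge0 ?exprn_ge0.
    have := t1 i iD; rewrite /x iM eqxx => H.
    have -> : w * 2 ^+ (i + r) / r%:R = m%:R * (w * 2 ^+ (i + r) / (r%:R * m%:R)).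
      by field; rewrite !lt0r_neq0.
    by rewrite ler_pM2l.
  + move=> iM; have [iD|Di] := leqP i (k - M * r); last by rewrite t2.
    have := t1 i iD; rewrite /x (negPf iM) lern0; by move/eqP.
Qed.

(** Level sizes are dominated by a geometric series of ratio [rho / 2]; near [rho = 1] the last
    factor is about [2], whence [2 ^+ k.+1] in the end. *)
Lemma profile_sum_le (R : realType) k r h (dl rho : R) (w : nat -> R) :
  (0 < r)%N -> (r <= k)%N -> (h <= r)%N -> 1 <= rho -> rho < 2 -> 0 <= dl ->
  (forall a, 0 <= w a <= dl * rho ^+ a) ->
  2 ^+ h * \sum_(i < (k - h).+1) profile R k r w i <=
  dl * 2 ^+ k / r%:R * (2 * rho / (2 - rho)).
Proof.
move=> r0 rk hr rho1 rho2 dl0 Hw.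
have rR : 0 < r%:R :> R by rewrite ltr0n.
have dl0' : 0 <= dl * 2 ^+ k / r%:R by rewrite !mulr_ge0 ?invr_ge0 ?exprn_ge0.
rewrite mulr_sumr (sum_ord_rev _ _ (fun i => 2 ^+ h * profile R k r w i)).
apply: (@le_trans _ _ (\sum_(v < (k - h).+1)
    dl * 2 ^+ k / r%:R * rho * (rho / 2) ^+ v)).
  apply: ler_sum => v _; have vk := ltn_ord v.
  rewrite /profile; have -> : (k - (k - h - v) = h + v)%N by lia.
  have -> : 2 ^+ k = 2 ^+ h * 2 ^+ (k - h - v) * 2 ^+ v :> R.
    by rewrite -!exprD; congr (_ ^+ _); lia.
  have -> : dl * (2 ^+ h * 2 ^+ (k - h - v) * 2 ^+ v) / r%:R * rho *
     (rho / 2) ^+ v = 2 ^+ h * (dl * rho ^+ v.+1 * 2 ^+ (k - h - v) / r%:R).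
    by rewrite exprMn exprS exprVn; field; rewrite !lt0r_neq0 ?exprn_gt0.
  rewrite ler_pM2l ?exprn_gt0 // ler_pM2r ?invr_gt0 // ler_pM2r ?exprn_gt0 //.
  have /andP[_ /le_trans->//] := Hw ((h + v) %/ r)%N.
  rewrite ler_wpM2l // ler_weXn2l //.
  (* Crude but sufficient: [h <= r] and [v <= v * r] bound the block index by [v + 1]. *)
  apply: (@leq_trans ((r + v * r) %/ r)); first by apply: leq_div2r; nia.
  by rewrite -mulSn mulnK.
rewrite -mulr_sumr -mulrA ler_wpM2l // mulrC.
have -> : 2 * rho / (2 - rho) = (1 - rho / 2)^-1 * rho.
  by field; apply/lt0r_neq0; lra.
rewrite ler_wpM2r ?(le_trans ler01) //.
have H : 0 < 1 - rho / 2 by lra.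
rewrite -[leRHS]mul1r ler_pdivlMr // mulrC.
have := subrX1 (rho / 2) (k - h).+1.
have : 0 <= (rho / 2) ^+ (k - h).+1 by rewrite exprn_ge0; lra.
set S := \sum_(i < _) _; set E := _ ^+ _; nra.
Qed.

(* Below a vertex with budget w take r full levels: m of the 2 ^ r bottom
   vertices share block M - 1 and are completed by Kraft's inequality, the
   others share the remaining blocks and get a fresh block 0. *)
Lemma profile_step (R : realType) k r M d m (dl rho : R) (w w' : nat -> R) :
  (0 < r)%N -> (0 < M)%N -> (M * r + 2 * r <= k)%N -> (k < M * r + 3 * r)%N ->
  1 <= rho -> rho < 2 -> 0 <= dl -> (m <= 2 ^ r)%N ->
  (forall a, 0 <= w a) -> (forall a, 0 <= w' a <= dl * rho ^+ a) ->
  (forall a, (M <= a)%N -> w' a = 0) ->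
  (forall a, (a.+1 < M)%N -> (2 ^+ r - m%:R) * w' a.+1 <= 2 ^+ r * w a) ->
  m%:R * (1 + (2 ^+ r)^-1) <= w M.-1 * 2 ^+ r ->
  dl * 2 ^+ k / r%:R * (2 * rho / (2 - rho)) + 2 ^+ (4 * r) <= d%:R ->
  constructible R k d (profile R k r w') -> constructible R k d (profile R k r w).
Proof.
move=> r0 M0 Mk kM rho1 rho2 dl0 mr w0 Hw' w'0 Hs Hm Hd cw'.
have rk : (r <= k)%N by nia.
have rR : 0 < r%:R :> R by rewrite ltr0n.
have main0 : 0 <= dl * 2 ^+ k / r%:R * (2 * rho / (2 - rho)).
  rewrite !mulr_ge0 ?invr_ge0 ?exprn_ge0 //; lra.
have [q [q1 q2 q3]] : exists q, [/\ forall i, (i + r <= k)%N ->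
      ((k - i) %/ r)%N = M ->
      m%:R * (leaves_at q i)%:R <= w M.-1 * 2 ^+ (i + r) / r%:R,
    forall i, ((k - i) %/ r)%N != M -> m%:R * (leaves_at q i)%:R = 0 :> R &
    (size (leaf_depths q) <= 2 ^ (k - M * r))%N].
  have [m0|m0] := posnP m.
    exists Leaf; split=> [i _ _|i _|]; rewrite ?m0 ?mul0r ?expn_gt0 //.
    by rewrite !mulr_ge0 ?invr_ge0 ?exprn_ge0.
  have [q [q1 q2 q3]] := killed_tree R k r M m _ r0 Mk m0 (w0 _) Hm.
  by exists q; split=> // i iM; rewrite q2 // mulr0.
(* At most [2 ^ r] copies of [q] are charged, each with at most [2 ^ (3 * r)] leaves. *)
have Lr : (k - M * r + r <= 4 * r)%N by lia.
have qd h : (h <= r)%N -> 2 ^+ h * (size (leaf_depths q))%:R <= 2 ^+ (4 * r) :> R.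
  move=> hr; rewrite -!natrX -natrM ler_nat.
  apply: (@leq_trans (2 ^ h * 2 ^ (k - M * r))); first by rewrite leq_mul2l q3 orbT.
  by rewrite -expnD leq_exp2l //; lia.
apply: (@constructible_graft R k d r m q _ _ rk mr cw').
- apply: locally_sparse_size; rewrite -(ler_nat R).
  by have := qd 0%N isT; rewrite expr0 mul1r; lra.
- by move=> i; apply: profile_ge0.
- move=> i ik; have e : ((k - i) %/ r = ((k - (i + r)) %/ r).+1)%N.
    by rewrite -[in LHS](subnK ik) addnA addnAC addnK divnDr ?divnn ?r0 ?addn1.
  rewrite /profile e; set a := ((k - (i + r)) %/ r)%N in e *.
  (* In turn: a block that survives, one beyond the last, and the last one, which goes entirely to
     the copies of [q]. *)
  have [aM|aM|aM] := ltngtP a.+1 M.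
  + rewrite q2 ?add0r; last by rewrite e neq_ltn aM.
    rewrite exprD !mulrA ler_pM2r ?invr_gt0 //.
    rewrite [leRHS](_ : _ = 2 ^+ r * w a * 2 ^+ i); last by ring.
    by rewrite ler_pM2r ?exprn_gt0 // Hs.
  + rewrite q2 ?add0r; last by rewrite e neq_ltn aM orbT.
    rewrite w'0 ?(ltnW aM) // !mul0r mulr0.
    by rewrite !mulr_ge0 ?invr_ge0 ?exprn_ge0.
  + rewrite w'0 ?aM // !mul0r mulr0 addr0.
    by have := q1 i ik; rewrite e aM -[in w a](succnK a) aM; apply.
- move=> h hr; rewrite mulrDr; apply: le_trans Hd; rewrite addrC lerD ?qd //.
  exact: profile_sum_le.
Qed.

(** The Kraft tree has no leaf deeper than [k], so bounding its total number of leaves gives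
    sparsity. The term [2 ^+ (M * r) / 2 ^+ k] pays for rounding. *)
Lemma profile_terminal (R : realType) k r M d (dl rho : R) (w : nat -> R) :
  (0 < r)%N -> (r <= k)%N -> (M * r <= k)%N ->
  1 <= rho -> rho < 2 -> 0 <= dl ->
  (forall a, 0 <= w a <= dl * rho ^+ a) ->
  1 + 2 ^+ (M * r) / 2 ^+ k <= \sum_(a < M) w a ->
  dl * 2 ^+ k / r%:R * (2 * rho / (2 - rho)) <= d%:R ->
  constructible R k d (profile R k r w).
Proof.
move=> r0 rk Mk rho1 rho2 dl0 Hw Hsum Hd.
have rR : 0 < r%:R :> R by rewrite ltr0n.
have kR : 0 < 2 ^+ k :> R by rewrite exprn_gt0.
have [|i||t [t1 t2 _]] := kraft_real R k (M * r) (profile R k r w).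
- exact: leqW.
- by apply: profile_ge0 => a; have /andP[] := Hw a.
- rewrite (eq_bigr (fun u : 'I_(M * r) => 2 ^+ k / r%:R * w (u %/ r)%N)).
    rewrite -mulr_sumr sum_ord_divn // mulrA divfK ?lt0r_neq0 //.
    rewrite -(@ler_pM2l _ (2 ^+ k)) // in Hsum; apply: le_trans Hsum.
    by rewrite mulrDr mulr1 mulrCA mulfV ?lt0r_neq0 // mulr1.
  move=> u _; have uk : (u <= k)%N by have := ltn_ord u; lia.
  rewrite /profile subKn // -[in RHS](subnK uk) exprD; ring.
exists t => //; apply: locally_sparse_size.
have -> : size (leaf_depths t) = leaves_within k t.
  symmetry; apply/eqP; rewrite -all_count; apply/allP => i it.
  rewrite leqNgt; apply/negP => ki; have := t2 i ki.
  by apply/eqP; rewrite -lt0n /leaves_at -has_count has_pred1.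
rewrite leaves_within_sum -(ler_nat R) natr_sum; apply: le_trans Hd.
apply: le_trans (@profile_sum_le R k r 0 dl rho w r0 rk isT rho1 rho2 dl0 Hw).
rewrite expr0 mul1r subn0; apply: ler_sum => i _; apply: t1.
by rewrite -ltnS.
Qed.

(** * Geometric weights and the change of their ratio *)

(** The steady state for growth by [rho] every [r] levels. At [rho = 0] only block [0] is filled,
    since [0 ^+ 0 = 1]. *)
Definition geometric_weights (R : realType) M (dl rho : R) (a : nat) : R :=
  if (a < M)%N then dl * rho ^+ a else 0.

(** Completing [m] of the [2 ^ r] vertices per step lets the surviving weights grow by [rho']; after
    [M] steps every block has entered under this growth. *)
Lemma geometric_phase (R : realType) k r M d m (dl rho rho' rhos : R) :
  (0 < r)%N -> (0 < M)%N -> (M * r + 2 * r <= k)%N -> (k < M * r + 3 * r)%N ->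
  0 <= rho -> rho <= rho' -> rho' <= rhos -> 1 <= rhos -> rhos < 2 -> 0 <= dl ->
  (m <= 2 ^ r)%N -> (2 ^+ r - m%:R) * rho' = 2 ^+ r ->
  m%:R * (1 + (2 ^+ r)^-1) <= dl * rho ^+ M.-1 * 2 ^+ r ->
  dl * 2 ^+ k / r%:R * (2 * rhos / (2 - rhos)) + 2 ^+ (4 * r) <= d%:R ->
  constructible R k d (profile R k r (geometric_weights R M dl rho')) ->
  constructible R k d (profile R k r (geometric_weights R M dl rho)).
Proof.
move=> r0 M0 Mk kM rho0 le1 le2 rhos1 rhos2 dl0 mr Hrho Hm Hd cw'.
(* State after [j] steps: the [j] newest blocks already have ratio [rho']. *)
pose mix j a : R :=
  if (a < M)%N then dl * (if (a < j)%N then rho' else rho) ^+ a else 0.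
have rho'0 : 0 <= rho' by apply: le_trans le1.
have mix0 j a : 0 <= mix j a.
  by rewrite /mix; case: ifP => // _; rewrite mulr_ge0 ?exprn_ge0 //; case: ifP.
suff mixP n j : (j + n)%N = M -> constructible R k d (profile R k r (mix j)).
  apply: constructible_le (mixP M 0%N (add0n M)) => i _.
  by rewrite /profile /mix /geometric_weights.
elim: n j => [|n IH] j.
  rewrite addn0 => ->; apply: constructible_le cw' => i _.
  by rewrite /profile /mix /geometric_weights; case: ifP.
move=> jn; apply: (@profile_step R k r M d m dl rhos (mix j) (mix j.+1)) => //.
- move=> a; rewrite mix0 /= /mix; case: ifP => _; last first.
    by rewrite mulr_ge0 ?exprn_ge0 // (le_trans ler01).
  have le3 := le_trans le1 le2.
  have rhos0 := le_trans ler01 rhos1.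
  by rewrite ler_wpM2l // lerXn2r // ?nnegrE //; case: ifP.
- by move=> a Ma; rewrite /mix ltnNge Ma.
- move=> a aM; rewrite /mix aM (ltnW aM) ltnS.
  have rm : 0 <= 2 ^+ r - m%:R :> R by rewrite subr_ge0 -natrX ler_nat.
  case: ifP => _; rewrite exprS.
    rewrite [leLHS](_ : _ = (2 ^+ r - m%:R) * rho' * (dl * rho' ^+ a)); last by ring.
    by rewrite Hrho.
  have -> : 2 ^+ r * (dl * rho ^+ a) = (2 ^+ r - m%:R) * (dl * (rho' * rho ^+ a)).
    transitivity ((2 ^+ r - m%:R) * rho' * (dl * rho ^+ a)); last by ring.
    by rewrite Hrho.
  by rewrite !ler_wpM2l // ler_wpM2r ?exprn_ge0.
- apply: le_trans Hm _; rewrite ler_wpM2r ?exprn_ge0 // /mix prednK // leqnn.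
  by rewrite ler_wpM2l // lerXn2r // ?nnegrE; case: ifP.
- by apply: IH; rewrite addSnnS.
Qed.

(** * Rate estimates and existence of the tree *)

(* From y <= expR (y - 1) at y = n (p + e): this is where 1 / e comes from. *)
Lemma killing_rate_bound (R : realType) n (p e : R) :
  (0 < n)%N -> p <= 1 ->
  (p + e) * (1 - p) ^+ n <= expR (n%:R * e - 1) / n%:R.
Proof.
move=> n0 p1; have nR : 0 < n%:R :> R by rewrite ltr0n.
have H1 : n%:R * (p + e) <= expR (n%:R * (p + e) - 1).
  by have := expR_ge1Dx (n%:R * (p + e) - 1); rewrite addrC subrK.
have H2 : (1 - p) ^+ n <= expR (n%:R * - p).
  rewrite mulrC expRM_natr.
  rewrite lerXn2r // ?nnegrE ?subr_ge0 ?expR_ge0 //; exact: expR_ge1Dx.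
rewrite ler_pdivlMr //.
have -> : n%:R * e - 1 = (n%:R * (p + e) - 1) + n%:R * - p by ring.
rewrite expRD.
apply: (@le_trans _ _ (expR (n%:R * (p + e) - 1) * (1 - p) ^+ n)).
  rewrite mulrAC [_ * n%:R]mulrC ler_wpM2r ?exprn_ge0 ?subr_ge0 //.
by rewrite ler_wpM2l ?expR_ge0.
Qed.

(** Bernoulli's inequality, term by term. *)
Lemma geometric_sum_ge (R : realType) n (p x : R) :
  0 <= p -> 1 + p <= x ->
  n%:R + p * (n%:R * (n%:R - 1) / 2) <= \sum_(a < n) x ^+ a.
Proof.
move=> p0 px.
have H a : 1 + a%:R * p <= x ^+ a.
  elim: a => [|a IH]; first by rewrite mul0r addr0 expr0.
  rewrite exprS; apply: (@le_trans _ _ ((1 + p) * (1 + a%:R * p))).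
    rewrite -natr1; have : 0 <= a%:R * p ^+ 2 :> R by rewrite mulr_ge0 ?exprn_ge0.
    by rewrite expr2; lra.
  by rewrite ler_pM // addr_ge0 ?mulr_ge0.
elim: n => [|n IH]; first by rewrite big_ord0; lra.
rewrite big_ord_recr /=; apply: le_trans (lerD IH (H n)).
by rewrite -natr1; lra.
Qed.

(** The bound of [killing_rate_bound] at [n = M - 1], [e = (2 ^+ r)^-1], times the rounding
    allowance of [killed_tree]. The summand [e] lets [m] rise by one per phase. *)
Definition entry_weight (R : realType) r M : R :=
  (1 + (2 ^+ r)^-1) * (expR (M.-1%:R / 2 ^+ r - 1) / M.-1%:R).

(** The growth [(1 - p)^-1] at [p = 11 / M], which bounds every fraction [p] in use. *)
Definition max_growth (R : realType) (M : nat) : R := (1 - 11 / M%:R)^-1.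

Lemma entry_weight_ge (R : realType) r M : (1 < M)%N ->
  (4 * M%:R)^-1 <= entry_weight R r M.
Proof.
move=> M1; have nR : 0 < M.-1%:R :> R by rewrite ltr0n; lia.
have eM : M%:R = M.-1%:R + 1 :> R by rewrite natr1 prednK // ltnW.
have N0 : 0 < (2 ^+ r)^-1 :> R by rewrite invr_gt0 exprn_gt0.
have e4 : 4^-1 <= expR (M.-1%:R / 2 ^+ r - 1) :> R.
  apply: (@le_trans _ _ (expR (-1))); last by rewrite ler_expR lerDr mulr_ge0 // ltW.
  have -> : -1 = 2%:R * (- 2^-1) :> R by lra.
  have := expR_ge1Dx (- 2^-1 : R); rewrite expRM_natl expr2; nra.
apply: (@le_trans _ _ (1 * (4^-1 / M.-1%:R))).
  rewrite mul1r -invfM lef_pV2 ?posrE ?mulr_gt0 ?eM ?addr_gt0 //; lra.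
rewrite ler_pM ?mulr_ge0 ?invr_ge0 ?(ltW nR) //; first by rewrite lerDl ltW.
by rewrite ler_pM2r // invr_gt0.
Qed.

(** Phase [m] completes [m] of the [2 ^ r] vertices per step, for [m] from [0] to [ms], until the
    total weight exceeds [1]. One entry weight serves all phases because [p] cancels in
    [killing_rate_bound]. *)
Lemma kd_tree_exists (R : realType) k r M d :
  (0 < r)%N -> (100 <= M)%N -> (M <= 2 ^ r)%N ->
  (M * r + 2 * r <= k)%N -> (k < M * r + 3 * r)%N ->
  entry_weight R r M * 2 ^+ k / r%:R *
    (2 * max_growth R M / (2 - max_growth R M)) + 2 ^+ (4 * r) <= d%:R ->
  exists t, is_kd_tree k d t.
Proof.
move=> r0 M100 MN Mk kM.
set dl := entry_weight R r M; set rhos := max_growth R M => Hd.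
have M0 : (0 < M)%N by lia.
have n0 : (0 < M.-1)%N by lia.
have Mk' : (M * r <= k)%N := leq_trans (leq_addr _ _) Mk.
have rk : (r <= k)%N by apply: leq_trans Mk'; rewrite leq_pmull.
have MR : 100 <= M%:R :> R by rewrite ler_nat.
have MR0 : 0 < M%:R :> R by lra.
set N : R := 2 ^+ r.
have N0 : 0 < N by rewrite exprn_gt0.
have MNR : M%:R <= N by rewrite /N -natrX ler_nat.
have dlge : (4 * M%:R)^-1 <= dl by apply: entry_weight_ge; lia.
have dl0 : 0 <= dl by apply: le_trans dlge; rewrite invr_ge0; lra.
have iM : 11 / M%:R <= 11 / 100 :> R by rewrite ler_pM2l // lef_pV2 ?posrE.
have iM0 : 0 < 11 / M%:R :> R by rewrite divr_gt0.
have rhos1 : 1 <= rhos by rewrite /rhos /max_growth invf_ge1; lra.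
have rhos2 : rhos < 2 by rewrite -[2]invrK ltf_pV2 ?posrE; lra.
pose rho (m : nat) : R := (1 - m%:R / N)^-1.
(* The least number of vertices beyond a fraction [10 / M]; as [M <= 2 ^ r], the fraction stays
   within [11 / M]. *)
pose ms := ((10 * 2 ^ r) %/ M).+1.
have ms1 : 10 / M%:R <= ms%:R / N.
  rewrite ler_pdivlMr // mulrAC ler_pdivrMr // /N -natrX -!natrM ler_nat /ms.
  by rewrite ltnW // ltn_ceil.
have ms2 : ms%:R / N <= 11 / M%:R.
  rewrite ler_pdivlMr // mulrAC ler_pdivrMr // /N -natrX -!natrM ler_nat /ms.
  by rewrite mulSn -[11%N]/(1 + 10)%N mulnDl mul1n leq_add // leq_trunc_div.
clearbody ms.
have msN m : (m <= ms)%N -> 0 <= m%:R / N <= 11 / M%:R.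
  move=> mm; rewrite divr_ge0 ?(ltW N0) //=; apply: le_trans ms2.
  by rewrite ler_pM2r ?invr_gt0 // ler_nat.
have rho0 m : (m <= ms)%N -> 0 < 1 - m%:R / N by move/msN => /andP[]; lra.
have rhoN m : (m <= ms)%N -> (N - m%:R) * rho m = N.
  move=> mm; have H := lt0r_neq0 (rho0 m mm).
  have -> : N - m%:R = N * (1 - m%:R / N).
    by rewrite mulrBr mulr1 mulrCA mulfV ?mulr1 // lt0r_neq0.
  by rewrite mulfK.
have rho_le m m' : (m <= m')%N -> (m' <= ms)%N -> rho m <= rho m'.
  move=> mm mm'; rewrite lef_pV2 ?posrE ?rho0 ?(leq_trans mm) //.
  by rewrite lerD2l lerN2 ler_pM2r ?invr_gt0 // ler_nat.
have rho_s m : (m <= ms)%N -> rho m <= rhos.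
  move=> mm; rewrite lef_pV2 ?posrE ?rho0 //; last by lra.
  by have /andP[] := msN m mm; lra.
have rho_ge1 m : (m <= ms)%N -> 1 <= rho m.
  by move=> mm; rewrite invf_ge1 ?rho0 //; have /andP[] := msN m mm; lra.
have rho_ge0 m : (m <= ms)%N -> 0 <= rho m.
  by move=> mm; rewrite (le_trans ler01) ?rho_ge1.
have rhos0 : 0 <= rhos := le_trans ler01 rhos1.
have msr : (ms <= 2 ^ r)%N.
  rewrite -(ler_nat R) natrX -/N -[leRHS]mul1r -ler_pdivrMr //; lra.
have chain n m : (m + n)%N = ms ->
    constructible R k d (profile R k r (geometric_weights R M dl (rho m))).
  elim: n m => [|n IH] m.
    rewrite addn0 => ->.
    apply: (@profile_terminal R k r M d dl rhos) => //.
    - move=> a; rewrite /geometric_weights; case: ifP => _.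
        rewrite mulr_ge0 ?exprn_ge0 ?rho_ge0 //=.
        by rewrite ler_wpM2l // lerXn2r // ?nnegrE ?rho_s ?rho_ge0.
      by rewrite lexx mulr_ge0 ?exprn_ge0.
    - rewrite (eq_bigr (fun a : 'I_M => dl * rho ms ^+ a)); last first.
        by move=> a _; rewrite /geometric_weights ltn_ord.
      rewrite -mulr_sumr.
      have P0 : 0 <= 10 / M%:R :> R by rewrite divr_ge0.
      have P1 : 1 + 10 / M%:R <= rho ms.
        rewrite -[leRHS]mul1r ler_pdivlMr ?rho0 //.
        have : 0 <= 10 / M%:R * (ms%:R / N) by rewrite mulr_ge0 // (le_trans P0).
        set y := 10 / _ in ms1 *; set z := ms%:R / N in ms1 *; lra.
      have := geometric_sum_ge R M _ _ P0 P1.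
      have -> : M%:R + 10 / M%:R * (M%:R * (M%:R - 1) / 2) = 6 * M%:R - 5 :> R.
        by field; rewrite lt0r_neq0.
      set S := \sum_(a < M) _ => HS.
      (* The final weight is thus at least [3 / 2 - 5 / (4 * M)], which covers [1] and a rounding
         cost of at most [1 / 4]. *)
      have : (4 * M%:R)^-1 * (6 * M%:R - 5) <= dl * S.
        by apply: ler_pM => //; rewrite ?invr_ge0; lra.
      apply: le_trans.
      have -> : (4 * M%:R)^-1 * (6 * M%:R - 5) = 3 / 2 - 5 / 4 / M%:R :> R.
        by field; rewrite lt0r_neq0.
      have H5 : 5 / 4 / M%:R <= 1 / 4 :> R by lra.
      have : 2 ^+ (M * r) / 2 ^+ k <= 1 / 4 :> R.
        rewrite ler_pdivrMr ?exprn_gt0 //.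
        have : 2 ^+ (M * r + 2) <= 2 ^+ k :> R.
          by rewrite ler_eXn2l ?ltr1n // (leq_trans _ Mk) // leq_add2l leq_pmulr.
        by rewrite exprD; lra.
      by lra.
    - by apply: le_trans Hd; rewrite lerDl exprn_ge0.
  move=> mn; have mm : (m.+1 <= ms)%N by rewrite -mn addnS ltnS leq_addr.
  have mm' := ltnW mm.
  apply: (@geometric_phase R k r M d m.+1 dl (rho m) (rho m.+1) rhos) => //.
  - exact: rho_ge0.
  - by apply: rho_le.
  - exact: rho_s.
  - exact: leq_trans msr.
  - exact: rhoN.
  (* Here [m + 1] vertices must be completed from an oldest block of ratio only [rho m]; the factor
     [rho m ^+ M.-1] cancels [(1 - m / N) ^+ M.-1]. *)
  - rewrite -/N.
    have p1 : m%:R / N <= 1 by have := rho0 m mm'; lra.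
    have := killing_rate_bound R M.-1 (m%:R / N) N^-1 n0 p1.
    set E := expR _ / _ => HE.
    have e1 : (1 - m%:R / N) ^+ M.-1 * rho m ^+ M.-1 = 1.
      by rewrite -exprMn mulfV ?expr1n // lt0r_neq0 // rho0.
    have rX : 0 <= rho m ^+ M.-1 by rewrite exprn_ge0 ?rho_ge0.
    have H : m%:R / N + N^-1 <= E * rho m ^+ M.-1.
      rewrite -[leLHS]mulr1 -[X in _ * X]e1 mulrA.
      by rewrite ler_wpM2r.
    rewrite -ler_pdivrMr // [leLHS](_ : _ = (1 + N^-1) * (m%:R / N + N^-1)); last first.
      by rewrite -natr1; field; rewrite lt0r_neq0.
    rewrite /dl /entry_weight -/N -/E -mulrA ler_wpM2l //.
    by rewrite addr_ge0 // invr_ge0 ltW.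
  - by apply: IH; rewrite addSnnS.
have c1 : constructible R k d (profile R k r (geometric_weights R M dl 1)).
  have -> : 1 = rho 0%N by rewrite /rho mul0r subr0 invr1.
  exact: (chain ms 0%N).
(* Start-up: with no vertex completed, [M] steps fill all blocks to the common weight [dl]. *)
have c0 : constructible R k d (profile R k r (geometric_weights R M dl 0)).
  apply: (@geometric_phase R k r M d 0 dl 0 1 rhos) => //.
  - by rewrite subr0 mulr1.
  - by rewrite mul0r !mulr_ge0 ?exprn_ge0.
apply: (@constructible0_kd_tree R).
have : constructible R k d (profile R k r (fun=> 0)); last first.
  by apply: constructible_le => i _; rewrite /profile !mul0r.
apply: (@profile_step R k r M d 0 dl rhos _ (geometric_weights R M dl 0)) => //.
- move=> a; rewrite /geometric_weights; case: ifP => _.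
    by rewrite mulr_ge0 ?exprn_ge0 //= ler_wpM2l // lerXn2r // ?nnegrE.
  by rewrite lexx mulr_ge0 ?exprn_ge0.
- by move=> a Ma; rewrite /geometric_weights ltnNge Ma.
- by move=> a aM; rewrite /geometric_weights aM exprS mul0r !mulr0.
- by rewrite !mul0r.
Qed.

(** * Choice of [r] and [M], and the asymptotic bound *)

Lemma sqrtn_exists k : exists r, (r * r <= k < r.+1 * r.+1)%N.
Proof.
elim: k => [|k [r /andP[rk kr]]]; first by exists 0%N.
have [lt|ge] := ltnP k.+1 (r.+1 * r.+1); first by exists r; rewrite lt andbT ltnW.
by exists r.+1; apply/andP; split; lia.
Qed.

Lemma sqrn_le_exp2 n : (4 <= n)%N -> (n * n <= 2 ^ n)%N.
Proof.
elim: n => // n IH; rewrite leq_eqVlt => /orP[/eqP <- //|n4].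
by have := IH n4; rewrite expnS; nia.
Qed.

Lemma expR_le_inv (R : realType) (x : R) : x < 1 -> expR x <= (1 - x)^-1.
Proof.
move=> x1; have x0 : 0 < 1 - x by lra.
rewrite -[leRHS]mul1r ler_pdivlMr // -[leRHS](expRxMexpNx_1 x) ler_wpM2l ?expR_ge0 //.
exact: expR_ge1Dx.
Qed.

(** With [M * M <= 2 ^ r], both [1 + (2 ^+ r)^-1] and [expR ((M - 1) / 2 ^+ r)] are [1 + O(1 / M)],
    which leaves [1 / (e M)] as the main term. *)
Lemma entry_weight_le (R : realType) r M : (2 <= M)%N -> (M * M <= 2 ^ r)%N ->
  entry_weight R r M <= (expR 1)^-1 * ((M%:R + 1) / (M%:R - 1) ^+ 2).
Proof.
move=> M2 MN; rewrite /entry_weight.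
have -> : M.-1%:R = M%:R - 1 :> R by rewrite -subn1 natrB // ltnW.
have : M%:R * M%:R <= 2 ^+ r :> R by rewrite -natrM -natrX ler_nat.
have : 2 <= M%:R :> R by rewrite ler_nat.
set N : R := 2 ^+ r; set mu : R := M%:R => mu2 HN.
have N0 : 0 < N by rewrite exprn_gt0.
have mu0 : 0 < mu by lra.
have mu1 : 0 < mu - 1 by lra.
have H1 : 1 + N^-1 <= (mu + 1) / mu.
  rewrite mulrDl mulfV ?lt0r_neq0 // mul1r lerD2l lef_pV2 ?posrE //; nra.
have H2 : expR ((mu - 1) / N - 1) <= (expR 1)^-1 * (mu / (mu - 1)).
  rewrite addrC expRD expRN ler_wpM2l ?invr_ge0 ?expR_ge0 //.
  apply: (@le_trans _ _ (expR mu^-1)).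
    rewrite ler_expR ler_pdivrMr // mulrC ler_pdivlMr //; nra.
  have -> : mu / (mu - 1) = (1 - mu^-1)^-1 by field; rewrite !lt0r_neq0.
  apply: expR_le_inv; rewrite invf_lt1 //; lra.
have -> : (expR 1)^-1 * ((mu + 1) / (mu - 1) ^+ 2) =
    (mu + 1) / mu * ((expR 1)^-1 * (mu / (mu - 1)) / (mu - 1)).
  by field; rewrite !lt0r_neq0 ?expR_gt0.
apply: ler_pM => //.
- by rewrite addr_ge0 ?invr_ge0 // ltW.
- by rewrite mulr_ge0 ?expR_ge0 ?invr_ge0 // ltW.
- by rewrite ler_pM2r ?invr_gt0.
Qed.

(** The bound [k <= (M + 3) * r] turns [1 / (M * r)] into [1 / k]; all corrections are factors
    [1 + O(1 / M)]. *)
Lemma tree_degree_le (R : realType) k r M : (100 <= M)%N -> (0 < r)%N ->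
  (M * M <= 2 ^ r)%N -> (0 < k)%N -> (k < M * r + 3 * r)%N ->
  entry_weight R r M * 2 ^+ k / r%:R *
    (2 * max_growth R M / (2 - max_growth R M)) <=
  2 ^+ k.+1 / (expR 1 * k%:R) * (1 + 60 / M%:R).
Proof.
move=> M100 r0 MN k0 kM.
have M2 : (1 < M)%N by apply: leq_trans M100.
have Hd := entry_weight_le R r M M2 MN.
have rR : 0 < r%:R :> R by rewrite ltr0n.
have kR : 0 < k%:R :> R by rewrite ltr0n.
have Hk : k%:R <= (M%:R + 3) * r%:R :> R.
  by rewrite mulrDl -natrM -[3]/(3%:R) -natrM -natrD ler_nat ltnW.
have mu100 : 100 <= M%:R :> R by rewrite ler_nat.
rewrite /max_growth; move: Hd Hk mu100; set mu : R := M%:R => Hd Hk mu100.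
have -> : 2 * (1 - 11 / mu)^-1 / (2 - (1 - 11 / mu)^-1) = 2 * (mu / (mu - 22)).
  by field; rewrite !lt0r_neq0 //; lra.
have Hr : r%:R^-1 <= (mu + 3) / k%:R.
  by rewrite ler_pdivlMr // mulrC ler_pdivrMr.
have e0 : 0 < expR 1 :> R by rewrite expR_gt0.
(* The left side is [1 + 28 / mu + O(1 / mu ^ 2)], so [60] leaves room at [mu >= 100]. *)
have Hc : (mu + 1) / (mu - 1) ^+ 2 * (mu + 3) * (mu / (mu - 22)) <= 1 + 60 / mu.
  have -> : (mu + 1) / (mu - 1) ^+ 2 * (mu + 3) * (mu / (mu - 22)) =
     (mu + 1) * (mu + 3) * mu / ((mu - 1) ^+ 2 * (mu - 22)).
    by field; rewrite !lt0r_neq0 //; lra.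
  have -> : 1 + 60 / mu = (mu + 60) / mu by field; rewrite lt0r_neq0; lra.
  rewrite ler_pdivrMr; last by rewrite mulr_gt0 ?exprn_gt0 //; lra.
  rewrite [leRHS]mulrAC ler_pdivlMr; last by lra.
  rewrite -subr_ge0 [leRHS](_ : _ = mu ^+ 2 * (32 * mu - 1398) +
     (2678 * mu - 1320)); last by ring.
  apply: addr_ge0; last by lra.
  apply: mulr_ge0; last by lra.
  apply: exprn_ge0; lra.
apply: (@le_trans _ _ ((expR 1)^-1 * ((mu + 1) / (mu - 1) ^+ 2) * 2 ^+ k *
    ((mu + 3) / k%:R) * (2 * (mu / (mu - 22))))).
  have dl0 : 0 <= entry_weight R r M.
    apply: le_trans (entry_weight_ge _ _ _ M2).
    by rewrite invr_ge0 mulr_ge0.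
  apply: ler_wpM2r; first by rewrite !mulr_ge0 ?invr_ge0 //; lra.
  apply: ler_pM => //; first by rewrite mulr_ge0 ?exprn_ge0.
  by rewrite ler_wpM2r ?exprn_ge0.
rewrite [leLHS](_ : _ = 2 ^+ k.+1 / (expR 1 * k%:R) *
  ((mu + 1) / (mu - 1) ^+ 2 * (mu + 3) * (mu / (mu - 22)))).
  by rewrite ler_wpM2l // mulr_ge0 ?exprn_ge0 // invr_ge0 mulr_ge0 // ltW.
by rewrite [2 ^+ k.+1]exprS; field; rewrite !lt0r_neq0 //; lra.
Qed.

(** Were [f2 k] larger, [kd_tree_exists] with [d = f2 k] would give a forbidden tree. In [121], the
    relative error [60 / M] with [sqrt k <= 2 * M] accounts for [120], and [2 ^+ (4 * r)] for [1];
    [110 * 110] ensures [M >= 100]. *)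
Lemma f2_le (R : realType) k : (110 * 110 <= k)%N ->
  (f2 k)%:R <= 2 ^+ k.+1 / (expR 1 * k%:R) +
    121 * (2 ^+ k.+1 / k%:R `^ (3 / 2)) :> R.
Proof.
move=> k110; have [r /andP[rk kr]] := sqrtn_exists k.
have r110 : (110 <= r)%N.
  rewrite leqNgt; apply/negP => r110; move: kr; apply/negP; rewrite -leqNgt.
  by apply: leq_trans k110; apply: leq_mul.
have r0 : (0 < r)%N by apply: leq_trans r110.
have k0 : (0 < k)%N by apply: leq_trans k110.
(* Taking [k %/ r - 2] leaves between [2 * r] and [3 * r] levels outside the blocks;
   [r <= k %/ r <= r + 2] keeps [M] close to [sqrt k]. *)
have [M [Mr rM Mk kM]] : exists M, [/\ (M <= r)%N, (r <= M.+2)%N,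
    (M * r + 2 * r <= k)%N & (k < M * r + 3 * r)%N].
  have q1 : (r <= k %/ r)%N by rewrite leq_divRL.
  have q2 : (k %/ r < r.+3)%N by rewrite ltn_divLR //; nia.
  have q3 := leq_trunc_div k r; have q4 := ltn_ceil k r0.
  exists (k %/ r - 2)%N; move: q1 q2 q3 q4; set q := (k %/ r)%N => q1 q2 q3 q4.
  have q5 : (2 <= q)%N by apply: leq_trans q1; apply: leq_trans r110.
  have e : q = (q - 2 + 2)%N by rewrite subnK.
  move: (q - 2)%N e => p e; rewrite e in q1 q2 q3 q4.
  by split; lia.
have M100 : (100 <= M)%N by apply: (@leq_trans 108) => //; rewrite -2!ltnS (leq_trans r110).
have rN : (r * r <= 2 ^ r)%N by apply: sqrn_le_exp2; apply: leq_trans r110.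
have MN : (M * M <= 2 ^ r)%N by apply: leq_trans rN; apply: leq_mul.
have kR : 0 < k%:R :> R by rewrite ltr0n.
set s : R := Num.sqrt k%:R.
have s0 : 0 < s by rewrite sqrtr_gt0.
have ss : s * s = k%:R by rewrite -expr2 sqr_sqrtr // ltW.
have -> : k%:R `^ (3 / 2) = k%:R * s :> R.
  have -> : 3 / 2 = 1 + 2^-1 :> R by lra.
  rewrite powRD ?powRr1 ?powR12_sqrt ?(ltW kR) //.
  by apply/implyP => _; rewrite lt0r_neq0.
have s_le (x : R) : 0 <= x -> k%:R <= x * x -> s <= x.
  by move=> x0 kx; rewrite leNgt; apply/negP => xs; nra.
have M6 : (6 <= M)%N by apply: leq_trans M100.
have M0 : 0 < M%:R :> R by rewrite ltr0n (leq_trans _ M6).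
have sM : s <= 2 * M%:R.
  apply: s_le; first exact: mulr_ge0.
  rewrite -[2]/(2%:R) -!natrM ler_nat.
  apply: (@leq_trans ((M + 3) * M.+2)); last by clear -M6; nia.
  by apply: leq_trans (ltnW kM) _; rewrite -mulnDl leq_mul2l rM orbT.
(* Since [k <= 4 ^ r] and [s <= 2 ^ r], it suffices that [7 * r <= r * r <= k]. *)
have small : 2 ^+ (4 * r) <= 2 ^+ k.+1 / (k%:R * s) :> R.
  rewrite ler_pdivlMr; last exact: mulr_gt0.
  have kN : k%:R <= 2 ^+ r * 2 ^+ r :> R.
    rewrite -!natrX -natrM ler_nat (leq_trans (ltnW kr)) //.
    by apply: leq_mul; apply: ltn_expl.
  have sN : s <= 2 ^+ r by apply: s_le kN; rewrite exprn_ge0.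
  apply: (@le_trans _ _ (2 ^+ (4 * r) * (2 ^+ r * 2 ^+ r * 2 ^+ r))).
    by rewrite ler_wpM2l ?exprn_ge0 // ler_pM // ltW.
  rewrite -!exprD ler_eXn2l ?ltr1n // (leq_trans _ (leqW rk)) //.
  apply: (@leq_trans (7 * r)); first by lia.
  by rewrite leq_mul2r (leq_trans _ r110) ?orbT.
have big : 2 ^+ k.+1 / (expR 1 * k%:R) * (60 / M%:R) <=
    120 * (2 ^+ k.+1 / (k%:R * s)) :> R.
  have e1 : 1 <= expR 1 :> R by have := expR_ge1Dx (1 : R); lra.
  rewrite [leLHS](_ : _ = 2 ^+ k.+1 / k%:R * ((expR 1)^-1 * (60 / M%:R))); last first.
    by field; rewrite !lt0r_neq0 ?expR_gt0.
  rewrite [leRHS](_ : _ = 2 ^+ k.+1 / k%:R * (1 * (120 / s))); last first.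
    by field; rewrite !lt0r_neq0.
  rewrite ler_wpM2l ?mulr_ge0 ?exprn_ge0 ?invr_ge0 //.
  rewrite ler_pM ?invr_ge0 ?expR_ge0 ?divr_ge0 //.
    by rewrite invf_le1 ?expR_gt0.
  by rewrite ler_pdivrMr // mulrAC ler_pdivlMr //; lra.
apply: contraT; rewrite -ltNge => /ltW H.
have [||||||t ht] := @kd_tree_exists R k r M (f2 k).
- by [].
- by [].
- apply: leq_trans MN; rewrite leq_pmulr //; exact: leq_trans M100.
- by [].
- by [].
- apply: le_trans H.
  have := tree_degree_le R k r M M100 r0 MN k0 kM; rewrite mulrDr mulr1; lra.
by have := f2_no_kd_tree k t; rewrite ht.
Qed.

Theorem theorem6 (R : realType) :
  exists2 h : nat -> R,
    h =O_\oo (fun k : nat => 2 ^+ k.+1 / k%:R `^ (3 / 2)) &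
    \forall k \near \oo,
      (f2 k)%:R <= 2 ^+ k.+1 / (expR 1 * k%:R) + h k.
Proof.
exists (fun k => 121 * (2 ^+ k.+1 / k%:R `^ (3 / 2))).
  apply/eqO_exP; exists 121 => //; near=> k.
  by rewrite normrM (ger0_norm (ler0n _ 121)).
near=> k; apply: f2_le; near: k; exact: nbhs_infty_ge.
Unshelve. all: by end_near.
Qed.
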